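(* The problems $\mathsf{LPO}$ and $\mathsf{LLPO}$ do not have an $n$-th root for any $n \geq 2$.
   Context: A problem is a partial multivalued function $f:\subseteq \mathbb{N}^\mathbb{N} \rightrightarrows \mathbb{N}^\mathbb{N}$; $\mathrm{dom}(f)$ is the set of $x$ with $f(x)\neq\emptyset$. Fix a standard computable pairing $\langle x,y\rangle$ of sequences. $f \le_W g$ iff there are partial computable $h,k:\subseteq\mathbb{N}^\mathbb{N}\to\mathbb{N}^\mathbb{N}$ such that for every $x\in\mathrm{dom}(f)$, $k(x)\in\mathrm{dom}(g)$ and for every $y\in g(k(x))$, $h(\langle x,y\rangle)\in f(x)$; $f\equiv_W g$ means both directions. The composition $f\circ g$ has domain $\{x\in\mathrm{dom}(g) : g(x)\subseteq \mathrm{dom}(f)\}$ and $(f\circ g)(x)=\{z : \exists y\in g(x),\ z\in f(y)\}$. The compositional product $f*g$ is a $\le_W$-maximum of $\{f'\circ g' : f'\le_W f,\ g'\le_W g\}$ (exists, unique up to $\equiv_W$). $f^{[0]}:=\mathrm{id}$, $f^{[n]}$ is the compositional product of $n$ copies of $f$; for $n\ge2$, $r$ is an $n$-th root of $f$ iff $f\equiv_W r^{[n]}$. For $n\in\mathbb{N}$ let $\mathbf{n}\in\mathbb{N}^\mathbb{N}$ be the constant sequence with value $n$. $\mathsf{LPO}:\mathbb{N}^\mathbb{N}\to\mathbb{N}^\mathbb{N}$ maps $x$ to $\mathbf{0}$ if $x$ has an entry equal to $0$, and to $\mathbf{1}$ otherwise. $\mathsf{LLPO}$ has domain the sequences with at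 most one non-zero entry, and $\mathsf{LLPO}(x)$ contains $\mathbf{0}$ iff $x$ is zero at all even indices, and contains $\mathbf{1}$ iff $x$ is zero at all odd indices. *)

(* Defs.v *)
From Stdlib Require Import Arith Cantor.

Definition baire : Type := nat -> nat.

(** Oracle mu-recursive functions, presented as unary functions on [nat] in
    which several arguments are packed with the Cantor bijection
    [Cantor.to_nat : nat * nat -> nat]. *)
Inductive code : Type :=
| CZero
| CSucc
| CFst
| CSnd
| COracle
| CPair (c d : code)
| CComp (c d : code)
| CPrec (c d : code)
| CMu (c : code).

(** [eval x c a v]: program [c] with oracle [x] halts on input [a] with
    output [v].
    - [CPrec c d] on <a, 0> is [c a], and on <a, n+1> it is
      [d <a, <n, u>>], where [u] is the value on <a, n>.
    - [CMu c] on [a] is the least [n] such that [c <a, n>] is 0, provided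
      [c <a, m>] halts for all [m < n]. *)
Fixpoint eval (x : baire) (c : code) : nat -> nat -> Prop :=
  match c with
  | CZero => fun _ v => v = 0
  | CSucc => fun a v => v = S a
  | CFst => fun a v => v = fst (of_nat a)
  | CSnd => fun a v => v = snd (of_nat a)
  | COracle => fun a v => v = x a
  | CPair c d => fun a v =>
      exists u w, eval x c a u /\ eval x d a w /\ v = to_nat (u, w)
  | CComp c d => fun a v => exists u, eval x d a u /\ eval x c u v
  | CPrec c d => fun m =>
      let (a, n) := of_nat m in
      nat_rect (fun _ => nat -> Prop)
        (fun v => eval x c a v)
        (fun i R v => exists u, R u /\ eval x d (to_nat (a, to_nat (i, u))) v)
        n
  | CMu c => fun a n =>
      eval x c (to_nat (a, n)) 0 /\
      forall m, m < n -> exists v, eval x c (to_nat (a, m)) (S v)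
  end.

(** Used both for graphs of partial single-valued functions and for
    multivalued functions: [f x y] means that [y] is a value of [f] at [x]. *)
Definition problem : Type := baire -> baire -> Prop.

Definition dom (f : problem) (x : baire) : Prop := exists y, f x y.

(** [F] is the graph of a partial computable function: some oracle program
    computes [F] on its domain, its behaviour elsewhere being irrelevant.
    Single-valuedness of [F] is implied, as programs are deterministic. *)
Definition computable (F : problem) : Prop :=
  exists c : code, forall x y, F x y -> forall n, eval x c n (y n).

(** <x, y> = x(0), y(0), x(1), y(1), ... *)
Definition bpair (x y : baire) : baire := fun n =>
  if Nat.even n then x (Nat.div2 n) else y (Nat.div2 n).

Definition wle (f g : problem) : Prop :=
  exists h k : problem, computable h /\ computable k /\
    forall x, dom f x ->
      exists z, k x z /\ dom g z /\
        forall y, g z y -> exists w, h (bpair x y) w /\ f x w.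

Definition weq (f g : problem) : Prop := wle f g /\ wle g f.

Definition compose (f g : problem) : problem := fun x z =>
  (forall y, g x y -> dom f y) /\ exists y, g x y /\ f y z.

(** [p] is a maximum, for [wle], of the set of all [compose f' g'] with
    [wle f' f] and [wle g' g]; such a [p] is unique up to [weq]. *)
Definition is_comp_product (f g p : problem) : Prop :=
  (exists f' g', wle f' f /\ wle g' g /\ p = compose f' g') /\
  (forall f' g', wle f' f -> wle g' g -> wle (compose f' g') p).

Definition id_problem : problem := fun x y => y = x.

(** [p] is a representative of the degree of [f] composed [n] times. *)
Fixpoint is_power (f : problem) (n : nat) (p : problem) : Prop :=
  match n with
  | 0 => p = id_problem
  | S m =>
      match m with
      | 0 => p = f
      | S _ => exists q, is_power f m q /\ is_comp_product f q p
      end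
  end.

Definition is_root (n : nat) (r f : problem) : Prop :=
  exists p, is_power r n p /\ weq f p.

Definition const_seq (n : nat) : baire := fun _ => n.

Definition LPO : problem := fun x y =>
  ((exists i, x i = 0) /\ y = const_seq 0) \/
  ((forall i, x i <> 0) /\ y = const_seq 1).

Definition LLPO : problem := fun x y =>
  (forall i j, x i <> 0 -> x j <> 0 -> i = j) /\
  ((y = const_seq 0 /\ forall i, x (2 * i) = 0) \/
   (y = const_seq 1 /\ forall i, x (2 * i + 1) = 0)).

(* Main.v *)
(** Both problems carry a topological obstruction: a point [x] of the domain
    with a family of sequences [X i] converging to [x], such that every
    solution [y] at [x] is isolated from the solutions along at least one
    [X i] (one sequence for [LPO], two for [LLPO]).  Computable functions being
    continuous, such a configuration is transported upwards by Weihrauch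
    reductions.  If it exists for [f o g] then it exists for [f] or [g]: when a
    solution [y] of [g] at [x] is a limit of solutions along all [X i], these
    solutions converging to [y] form a configuration for [f].  Hence a root
    [r], and then also [q := r^[n-1]], has one; the two combine in the parallel
    product of [r] and [q], which reduces to [r * q].  The combined
    configuration moves up to [LPO] (respectively [LLPO]), where it is
    impossible. *)
From Stdlib Require Import Arith Cantor Lia Classical IndefiniteDescription
  FunctionalExtensionality.
Require Import Defs.

(** * Continuity of oracle computations *)

Definition agree (n : nat) (x y : baire) : Prop := forall i, i < n -> x i = y i.

Lemma agree_le m n x y : m <= n -> agree n x y -> agree m x y.
Proof. intros H A i Hi; apply A; lia. Qed.

Lemma eval_functional x c : forall a v w, eval x c a v -> eval x c a w -> v = w.
Proof.
induction c as [| | | | |c IHc d IHd|c IHc d IHd|c IHc d IHd|c IHc];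
  simpl; intros a v w; try congruence.
- intros (u & t & Hu & Ht & ->) (u' & t' & Hu' & Ht' & ->).
  now rewrite (IHc _ _ _ Hu Hu'), (IHd _ _ _ Ht Ht').
- intros (u & Hu & Hv) (u' & Hu' & Hw).
  rewrite (IHd _ _ _ Hu Hu') in Hv; eauto.
- destruct (of_nat a) as [b n]; revert v w; induction n as [|n IHn]; simpl.
  + eauto.
  + intros v w (u & Hu & Hv) (u' & Hu' & Hw).
    rewrite (IHn _ _ Hu Hu') in Hv; eauto.
- intros [Hv Lv] [Hw Lw].
  destruct (Nat.lt_trichotomy v w) as [H|[H|H]]; auto.
  + destruct (Lw _ H) as [u Hu]; discriminate (IHc _ _ _ Hv Hu).
  + destruct (Lv _ H) as [u Hu]; discriminate (IHc _ _ _ Hw Hu).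
Qed.

(** A halting run queries only finitely many oracle entries; [N] bounds their positions. *)
Lemma eval_continuous x c : forall a v, eval x c a v ->
  exists N, forall x', agree N x x' -> eval x' c a v.
Proof.
induction c as [| | | | |c IHc d IHd|c IHc d IHd|c IHc d IHd|c IHc];
  simpl; intros a v.
1-4: intros ->; exists 0; auto.
- intros ->; exists (S a); intros x' A; apply A; lia.
- intros (u & t & Hu & Ht & ->).
  destruct (IHc _ _ Hu) as [N HN], (IHd _ _ Ht) as [M HM].
  exists (max N M); intros x' A; exists u, t; repeat split;
    [apply HN|apply HM]; eapply agree_le; try eassumption; lia.
- intros (u & Hu & Hv).
  destruct (IHc _ _ Hv) as [N HN], (IHd _ _ Hu) as [M HM].
  exists (max N M); intros x' A; exists u; split;
    [apply HM|apply HN]; eapply agree_le; try eassumption; lia.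
- destruct (of_nat a) as [b n]; revert v; induction n as [|n IHn]; simpl.
  + auto.
  + intros v (u & Hu & Hv).
    destruct (IHn _ Hu) as [N HN], (IHd _ _ Hv) as [M HM].
    exists (max N M); intros x' A; exists u; split;
      [apply HN|apply HM]; eapply agree_le; try eassumption; lia.
- intros [Hv Lv].
  destruct (IHc _ _ Hv) as [N HN].
  (* Minimisation runs [c] for every [m < v]; the bounds of these finitely many runs are combined by
     induction on [v]. *)
  assert (exists M, forall x', agree M x x' ->
    forall m, m < v -> exists w, eval x' c (to_nat (a, m)) (S w)) as [M HM].
  { clear Hv N HN; induction v as [|v IHv]; [exists 0; intros; lia|].
    destruct IHv as [M HM]; [intros m Hm; apply Lv; lia|].
    destruct (Lv v) as [w Hw]; [lia|].
    destruct (IHc _ _ Hw) as [M' HM'].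
    exists (max M M'); intros x' A m Hm.
    destruct (Nat.eq_dec m v) as [->|Hne].
    - exists w; apply HM'; eapply agree_le; try eassumption; lia.
    - apply HM; [eapply agree_le; try eassumption; lia|lia]. }
  exists (max N M); intros x' A; split;
    [apply HN|apply HM]; eapply agree_le; try eassumption; lia.
Qed.

Lemma computable_continuous F x y n : computable F -> F x y ->
  exists N, forall x' y', agree N x x' -> F x' y' -> agree n y y'.
Proof.
intros [c Hc] Hxy; induction n as [|n [N HN]].
- exists 0; intros x' y' _ _ i Hi; lia.
- destruct (eval_continuous _ _ _ _ (Hc _ _ Hxy n)) as [M HM].
  exists (max N M); intros x' y' A Hx' i Hi.
  destruct (Nat.eq_dec i n) as [->|Hne].
  + eapply eval_functional; [|exact (Hc _ _ Hx' n)].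
    apply HM; eapply agree_le; try eassumption; lia.
  + eapply HN; [eapply agree_le; try eassumption; lia|eassumption|lia].
Qed.

(** * Convergence and isolated solutions *)

Definition conv (X : nat -> baire) (x : baire) : Prop :=
  forall n, exists K, forall k, K <= k -> agree n x (X k).

Definition approach (f : problem) (X : nat -> baire) (x : baire) : Prop :=
  dom f x /\ (forall k, dom f (X k)) /\ conv X x.

(** [y] is not a limit of solutions along any subsequence of [X]. *)
Definition isolated (f : problem) (X : nat -> baire) (y : baire) : Prop :=
  exists m, forall k, m <= k -> forall z, f (X k) z -> ~ agree m y z.

Lemma bpair_even x y n : bpair x y (2 * n) = x n.
Proof.
unfold bpair; rewrite Nat.even_even, Nat.div2_double; reflexivity.
Qed.

Lemma bpair_odd x y n : bpair x y (S (2 * n)) = y n.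
Proof.
unfold bpair; rewrite Nat.div2_succ_double.
replace (S (2 * n)) with (2 * n + 1) by lia.
rewrite Nat.even_odd; reflexivity.
Qed.

Lemma agree_bpair n x y x' y' :
  agree n x x' -> agree n y y' -> agree n (bpair x y) (bpair x' y').
Proof.
intros A B i Hi; unfold bpair.
assert (Nat.div2 i < n) by (pose proof (Nat.le_div2_diag_l i); lia).
destruct (Nat.even i); auto.
Qed.

Lemma agree_bpair_l n x y x' y' :
  agree (2 * n) (bpair x y) (bpair x' y') -> agree n x x'.
Proof.
intros A i Hi; rewrite <- (bpair_even x y), <- (bpair_even x' y'); apply A; lia.
Qed.

Lemma agree_bpair_r n x y x' y' :
  agree (2 * n) (bpair x y) (bpair x' y') -> agree n y y'.
Proof.
intros A i Hi; rewrite <- (bpair_odd x y), <- (bpair_odd x' y'); apply A; lia.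
Qed.

Lemma conv_bpair X Y x y :
  conv X x -> conv Y y -> conv (fun k => bpair (X k) (Y k)) (bpair x y).
Proof.
intros HX HY n; destruct (HX n) as [K HK], (HY n) as [L HL].
exists (max K L); intros k Hk; apply agree_bpair; [apply HK|apply HL]; lia.
Qed.

Lemma conv_const x : conv (fun _ => x) x.
Proof. intros n; exists 0; intros k _ i _; reflexivity. Qed.

Lemma wle_transport f g : wle f g ->
  exists K : baire -> baire,
    (forall x, dom f x -> dom g (K x)) /\
    (forall X x, approach f X x -> approach g (fun k => K (X k)) (K x)) /\
    (forall x y, dom f x -> g (K x) y ->
       exists w, f x w /\ forall X, approach f X x ->
         isolated f X w -> isolated g (fun k => K (X k)) y).
Proof.
intros (h & k & Ch & Ck & H).
assert (exists K : baire -> baire, forall x, dom f x ->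
  k x (K x) /\ dom g (K x) /\
  forall y, g (K x) y -> exists w, h (bpair x y) w /\ f x w) as [K HK].
{ apply (functional_choice (fun x z => dom f x -> k x z /\ dom g z /\
    forall y, g z y -> exists w, h (bpair x y) w /\ f x w)).
  intros x; destruct (classic (dom f x)) as [D|D].
  - destruct (H x D) as [z Hz]; eauto.
  (* Outside the domain of [f] the value of [K] is arbitrary. *)
  - exists x; tauto. }
exists K; split; [|split].
- intros x Dx; apply HK, Dx.
- intros X x (Dx & DX & HX); split; [apply HK, Dx|split].
  + intros j; apply HK, DX.
  + intros n.
    destruct (computable_continuous _ _ _ n Ck (proj1 (HK x Dx))) as [N HN].
    destruct (HX N) as [J HJ]; exists J; intros j Hj.
    eapply HN; [apply HJ, Hj|apply HK, DX].
- intros x y Dx Hy.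
  destruct (HK x Dx) as (_ & _ & Hh); destruct (Hh y Hy) as (w & Hw & Fw).
  exists w; split; [exact Fw|]; intros X (_ & DX & HX) [m Hm].
  destruct (computable_continuous _ _ _ m Ch Hw) as [N HN].
  destruct (HX N) as [J HJ].
  (* From [J] on the inputs agree up to [N]; if [z] also agrees with [y] up to [N], then [w'] agrees
     with [w] up to [m], against the isolation of [w]. *)
  exists (max m (max N J)); intros j Hj z Hz A.
  destruct (HK (X j) (DX j)) as (_ & _ & Hhj).
  destruct (Hhj z Hz) as (w' & Hw' & Fw').
  apply (Hm j ltac:(lia) w' Fw').
  eapply HN; [|exact Hw'].
  apply agree_bpair; [apply HJ; lia|eapply agree_le; try eassumption; lia].
Qed.

Lemma wle_dom f g : wle f g -> (exists x, dom f x) -> exists x, dom g x.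
Proof.
intros (h & k & _ & _ & H) [x Dx]; destruct (H x Dx) as (z & _ & Dz & _); eauto.
Qed.

(** * Branching problems *)

Definition branching (I : Type) (f : problem) : Prop :=
  exists x (X : I -> nat -> baire),
    dom f x /\ (forall i, approach f (X i) x) /\
    forall y, f x y -> exists i, isolated f (X i) y.

Lemma branching_dom I f : branching I f -> exists x, dom f x.
Proof. intros (x & _ & D & _); eauto. Qed.

Lemma branching_wle I f g : wle f g -> branching I f -> branching I g.
Proof.
intros W (x & X & Dx & HX & Hy).
destruct (wle_transport _ _ W) as (K & KD & Kapp & Kiso).
exists (K x), (fun i k => K (X i k)); repeat split.
- apply KD, Dx.
- apply KD, Dx.
- intros k; apply KD, HX.
- apply (Kapp _ _ (HX i)).
- intros y Gy.
  destruct (Kiso x y Dx Gy) as (w & Fw & Hw).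
  destruct (Hy w Fw) as [i Hi]; exists i; auto.
Qed.

Lemma branching_compose I f g :
  branching I (compose f g) -> branching I f \/ branching I g.
Proof.
intros (x & X & Dx & HX & Hy).
assert (Dg : forall u, dom (compose f g) u ->
  dom g u /\ forall y, g u y -> dom f y).
{ intros u (w & Hd & y & Gy & _); split; [exists y|]; auto. }
destruct (classic (exists y, g x y /\ forall i, ~ isolated g (X i) y))
  as [(y & Gy & Hni)|Hni].
- left.
  (* Failure of isolation along [X i] gives, for every precision [j], an index [k >= j] and a
     solution of [g] at [X i k] agreeing with [y] up to [j]; [Z (i, j)] chooses such a pair. *)
  assert (exists Z : I * nat -> nat * baire, forall p,
    snd p <= fst (Z p) /\ g (X (fst p) (fst (Z p))) (snd (Z p)) /\
    agree (snd p) y (snd (Z p))) as [Z HZ].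
  { apply (functional_choice (fun p q => snd p <= fst q /\
      g (X (fst p) (fst q)) (snd q) /\ agree (snd p) y (snd q))).
    intros [i j]; simpl; apply NNPP; intros Hn; apply (Hni i).
    exists j; intros k Hk z Gz A; apply Hn; exists (k, z); auto. }
  assert (Dy : dom f y) by (apply (Dg x); auto).
  exists y, (fun i j => snd (Z (i, j))); split; [exact Dy|split].
  + intros i; split; [exact Dy|split].
    * intros j; destruct (HZ (i, j)) as (_ & Gz & _).
      eapply Dg; [apply HX|exact Gz].
    * intros n; exists n; intros j Hj.
      destruct (HZ (i, j)) as (_ & _ & A).
      eapply agree_le; [exact Hj|exact A].
  + intros w Fw.
    (* [w] also solves the composition at [x]; its isolation along [X i] passes to the chosen
       solutions, whose indices are at least [j]. *)
    destruct (Hy w) as [i [m Hm]].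
    { split; [apply Dg; auto|eauto]. }
    exists i, m; intros j Hj z Fz.
    destruct (HZ (i, j)) as (Hk & Gz & _); simpl in Hk, Gz.
    apply (Hm (fst (Z (i, j)))); [lia|].
    split; [apply Dg, HX|eauto].
- right; exists x, X; split; [apply Dg, Dx|split].
  + intros i; destruct (HX i) as (_ & DX & Cv).
    split; [apply Dg, Dx|split; [intros k; apply Dg, DX|exact Cv]].
  + intros y Gy; apply NNPP; intros Hn; apply Hni.
    exists y; split; [exact Gy|]; intros i Hi; apply Hn; eauto.
Qed.

(** A power is a composition of problems below [r] and below the previous power, so branching
    descends to [r] at once or by induction. *)
Lemma branching_power I r n p :
  is_power r (S n) p -> branching I p -> branching I r.
Proof.
revert p; induction n as [|n IHn]; intros p.
- intros ->; auto.
- intros (q & Hq & (f & g & Wf & Wg & ->) & _) [B|B]%branching_compose.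
  + exact (branching_wle _ _ _ Wf B).
  + exact (IHn _ Hq (branching_wle _ _ _ Wg B)).
Qed.

Lemma comp_product_dom f g p :
  is_comp_product f g p -> (exists x, dom p x) -> exists x, dom g x.
Proof.
intros ((f' & g' & _ & W & ->) & _) (x & w & _ & y & Gy & _).
apply (wle_dom _ _ W); exists x, y; exact Gy.
Qed.

(** * Parallel products *)

(** Apply [f] to the subsequence [x o e] of the input [x], and keep [x]. *)
Definition attach (e : nat -> nat) (f : problem) : problem := fun x w =>
  exists y, f (fun n => x (e n)) y /\ w = bpair x y.

Lemma attach_wle c e f :
  (forall x n, eval x c n (e n)) -> wle (attach e f) f.
Proof.
intros Hc.
(* The backward map is the identity, since an output of [attach e f] is already the pair of input
   and solution. *)
exists (fun x y => y = x), (fun x y => y = fun n => x (e n)).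
split; [exists COracle; intros x y -> n; reflexivity|split].
- exists (CComp COracle c); intros x y -> n; exists (e n); split; [apply Hc|reflexivity].
- intros x (w & y & Hy & _).
  exists (fun n => x (e n)); split; [reflexivity|split; [exists y; exact Hy|]].
  intros z Hz; exists (bpair x z); split; [reflexivity|exists z; auto].
Qed.

(** The argument [n] is packed as [<0, n>], where [CPair CFst CSnd] acts as the identity. The
    recursion starts at 0 and adds two at each step; [CComp CSnd CSnd] extracts the previous value
    [u] from [<0, <i, u>>]. *)
Definition double_code : code :=
  CComp (CPrec CZero (CComp CSucc (CComp CSucc (CComp CSnd CSnd))))
        (CPair CZero (CPair CFst CSnd)).

Lemma eval_double x n : eval x double_code n (2 * n).
Proof.
exists (to_nat (0, n)); split.
- exists 0, n; repeat split.
  exists (fst (of_nat n)), (snd (of_nat n)); repeat split.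
  now rewrite <- surjective_pairing, cancel_to_of.
- cbn [eval]; rewrite cancel_of_to.
  induction n as [|n IHn]; [reflexivity|].
  exists (2 * n); split; [exact IHn|].
  exists (S (2 * n)); split; [|lia].
  exists (2 * n); split; [|reflexivity].
  exists (to_nat (n, 2 * n)); now rewrite !cancel_of_to.
Qed.

(** On [bpair u v]: the inner problem solves [q] at [v] and outputs
    [bpair (bpair u v) y]; the outer one then reads [u] off at the indices
    [4 * n]. *)
Definition par (r q : problem) : problem :=
  compose (attach (fun n => 2 * (2 * n)) r) (attach (fun n => S (2 * n)) q).

Lemma par_wle r q p : is_comp_product r q p -> wle (par r q) p.
Proof.
intros [_ H]; apply H.
- apply (attach_wle (CComp double_code double_code)).
  intros x n; exists (2 * n); split; apply eval_double.
- apply (attach_wle (CComp CSucc double_code)).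
  intros x n; exists (2 * n); split; [apply eval_double|reflexivity].
Qed.

(** The outer problem reads [u] whichever [y] the inner one returns, so the domain condition of
    [compose] follows from [dom r u]. *)
Lemma par_spec r q u v w : dom r u ->
  par r q (bpair u v) w <->
  exists y z, q v y /\ r u z /\ w = bpair (bpair (bpair u v) y) z.
Proof.
intros [z0 Hz0].
assert (Ev : (fun n => bpair u v (S (2 * n))) = v)
  by (extensionality n; apply bpair_odd).
assert (Eu : forall y,
  (fun n => bpair (bpair u v) y (2 * (2 * n))) = u)
  by (intros y; extensionality n; rewrite !bpair_even; reflexivity).
unfold par, compose, attach; rewrite Ev; split.
- intros (_ & t & (y & Qy & ->) & z & Rz & ->).
  rewrite Eu in Rz; eauto.
- intros (y & z & Qy & Rz & ->); split.
  + intros t (y' & _ & ->); exists (bpair (bpair (bpair u v) y') z0), z0.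
    rewrite Eu; auto.
  + exists (bpair (bpair u v) y); split; [eauto|].
    exists z; rewrite Eu; auto.
Qed.

Lemma par_dom r q u v : dom r u -> dom q v -> dom (par r q) (bpair u v).
Proof.
intros Du [y Qy]; pose proof Du as [z Rz].
exists (bpair (bpair (bpair u v) y) z); apply par_spec; eauto.
Qed.

Lemma par_approach r q U V u v :
  approach r U u -> approach q V v ->
  approach (par r q) (fun k => bpair (U k) (V k)) (bpair u v).
Proof.
intros (Du & DU & CU) (Dv & DV & CV); split; [|split].
- apply par_dom; auto.
- intros k; apply par_dom; auto.
- apply conv_bpair; auto.
Qed.

Lemma approach_const f x : dom f x -> approach f (fun _ => x) x.
Proof. intros D; split; [|split]; auto using conv_const. Qed.

Lemma par_isolated r q U V s y z :
  (forall k, dom r (U k)) -> isolated r U z \/ isolated q V y ->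
  isolated (par r q) (fun k => bpair (U k) (V k)) (bpair (bpair s y) z).
Proof.
(* Each [bpair] halves the length of agreement, and [y] lies two levels deep. *)
intros DU [[m Hm]|[m Hm]]; exists (2 * (2 * m)); intros k Hk w;
  rewrite (par_spec r q (U k) (V k) w (DU k)); intros (y' & z' & Qy & Rz & ->) A.
- apply (Hm k ltac:(lia) z' Rz).
  apply agree_bpair_r in A; eapply agree_le; [|exact A]; lia.
- apply (Hm k ltac:(lia) y' Qy).
  apply agree_bpair_l, agree_bpair_r in A; exact A.
Qed.

(** The input of [q] is frozen at [v]; only the [r] component moves, and it isolates. *)
Lemma branching_par I r q :
  branching I r -> (exists v, dom q v) -> branching I (par r q).
Proof.
intros (x & X & Dx & HX & Hy) [v Dv].
exists (bpair x v), (fun i k => bpair (X i k) v); split; [|split].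
- apply par_dom; auto.
- intros i; apply (par_approach _ _ _ (fun _ => v)); auto using approach_const.
- intros w (y & z & Qy & Rz & ->)%par_spec; auto.
  destruct (Hy z Rz) as [i Hi]; exists i.
  apply (par_isolated _ _ _ (fun _ => v)); [apply HX|auto].
Qed.

(** No induction: in a product of [r] with a lower power, the branching of [r] alone passes to
    [par], which lies below the product. *)
Lemma branching_power_of_root I r n q :
  is_power r (S n) q -> branching I r -> (exists x, dom q x) -> branching I q.
Proof.
destruct n as [|n].
- intros ->; auto.
- intros (q' & _ & P) B D.
  apply (branching_wle _ _ _ (par_wle _ _ _ P)), branching_par; auto.
  exact (comp_product_dom _ _ _ P D).
Qed.

(** Branching goes up from [f] to the [n]-th power [p], down to [r], and up again to the power [q]
    of exponent [n - 1], which is positive as [2 <= n]. *)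
Lemma branching_root I n r f : 2 <= n -> is_root n r f -> branching I f ->
  exists q p, branching I r /\ branching I q /\ wle (par r q) p /\ wle p f.
Proof.
intros Hn (p & Hp & Wfp & Wpf) B.
destruct n as [|[|n]]; [lia|lia|].
pose proof (branching_wle _ _ _ Wfp B) as Bp.
pose proof (branching_power _ _ _ _ Hp Bp) as Br.
destruct Hp as (q & Hq & P).
exists q, p; split; [exact Br|split; [|split; [|exact Wpf]]].
- apply (branching_power_of_root _ _ _ _ Hq Br).
  exact (comp_product_dom _ _ _ P (branching_dom _ _ Bp)).
- exact (par_wle _ _ _ P).
Qed.

(** * The problem [LPO] *)

(** A single zero at position [k] moves off to infinity. The two answers differ at their first
    entry, whence the precision 1. *)
Lemma branching_LPO : branching unit LPO.
Proof.
assert (D1 : LPO (const_seq 1) (const_seq 1))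
  by (right; split; [intros i; discriminate|reflexivity]).
assert (Dk : forall k, LPO (fun i => if i =? k then 0 else 1) (const_seq 0))
  by (intros k; left; split; [exists k; now rewrite Nat.eqb_refl|reflexivity]).
exists (const_seq 1), (fun _ k i => if i =? k then 0 else 1); split; [|split].
- eexists; exact D1.
- intros _; split; [eexists; exact D1|split].
  + intros k; eexists; apply Dk.
  + intros n; exists n; intros k Hk i Hi; unfold const_seq.
    destruct (Nat.eqb_spec i k); [lia|reflexivity].
- intros y [[[i Hi] _]|[_ ->]]; [discriminate|].
  exists tt, 1; intros k _ z [[_ ->]|[Hz _]] A.
  + discriminate (A 0 ltac:(lia)).
  + apply (Hz k); now rewrite Nat.eqb_refl.
Qed.

(** A solution may have to be revised twice along converging inputs. *)
Definition nested (f : problem) : Prop :=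
  exists x (X : nat -> baire) (XX : nat -> nat -> baire),
    (approach f X x /\ forall y, f x y -> isolated f X y) /\
    forall j, approach f (XX j) (X j) /\
      forall y, f (X j) y -> isolated f (XX j) y.

Lemma nested_wle f g : wle f g -> nested f -> nested g.
Proof.
intros W (x & X & XX & [HX Hy] & HXX).
destruct (wle_transport _ _ W) as (K & KD & Kapp & Kiso).
assert (T : forall X x, approach f X x -> (forall y, f x y -> isolated f X y) ->
  approach g (fun k => K (X k)) (K x) /\
  forall y, g (K x) y -> isolated g (fun k => K (X k)) y).
{ intros U u HU Hu; split; [exact (Kapp _ _ HU)|]; intros y Gy.
  destruct (Kiso u y (proj1 HU) Gy) as (w & Fw & Hw); auto. }
exists (K x), (fun j => K (X j)), (fun j k => K (XX j k)); split.
- exact (T _ _ HX Hy).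
- intros j; destruct (HXX j) as [H1 H2]; exact (T _ _ H1 H2).
Qed.

(** The outer level perturbs only the input of [q], the inner ones only that of [r]; at each level
    the moving component isolates. *)
Lemma nested_par r q :
  branching unit r -> branching unit q -> nested (par r q).
Proof.
intros (x & X & Dx & HX & Hx) (v & V & Dv & HV & Hv).
specialize (HX tt); specialize (HV tt).
exists (bpair x v), (fun j => bpair x (V tt j)),
  (fun j k => bpair (X tt k) (V tt j)); split; [|intros j].
- split; [apply (par_approach _ _ (fun _ => x)); auto using approach_const|].
  intros w (y & z & Qy & Rz & ->)%par_spec; auto.
  destruct (Hv y Qy) as [[] Hi].
  apply (par_isolated _ _ (fun _ => x)); auto.
- assert (Dj : dom q (V tt j)) by apply HV.
  split; [apply (par_approach _ _ _ (fun _ => V tt j)); auto using approach_const|].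
  intros w (y & z & Qy & Rz & ->)%par_spec; auto.
  destruct (Hx z Rz) as [[] Hi].
  apply (par_isolated _ _ _ (fun _ => V tt j)); [apply HX|auto].
Qed.

Lemma LPO_not_isolated_0 X x : (exists i, x i = 0) -> conv X x ->
  ~ isolated LPO X (const_seq 0).
Proof.
intros [i Hi] HX [m Hm]; destruct (HX (S i)) as [K HK].
apply (Hm (max m K) ltac:(lia) (const_seq 0)); [|intros j _; reflexivity].
left; split; [exists i|reflexivity].
rewrite <- (HK (max m K) ltac:(lia) i ltac:(lia)); exact Hi.
Qed.

(** Only one revision is possible, from 1 to 0: isolation at [x] forces the answer 1 there and a
    zero in [X m], and such a zero persists along [XX m]. *)
Lemma not_nested_LPO : ~ nested LPO.
Proof.
intros (x & X & XX & [(_ & _ & HX) Hx] & HXX).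
destruct (classic (exists i, x i = 0)) as [Hz|Hz].
- apply (LPO_not_isolated_0 X x Hz HX), Hx; left; auto.
- destruct (Hx (const_seq 1)) as [m Hm].
  { right; split; [intros i Hi; apply Hz; eauto|reflexivity]. }
  destruct (HXX m) as [(_ & _ & HXm) Hxm].
  destruct (classic (exists i, X m i = 0)) as [Hzm|Hzm].
  + apply (LPO_not_isolated_0 (XX m) (X m) Hzm HXm), Hxm; left; auto.
  + apply (Hm m (le_n m) (const_seq 1)); [|intros i _; reflexivity].
    right; split; [intros i Hi; apply Hzm; eauto|reflexivity].
Qed.

(** * The problem [LLPO] *)

Lemma branching_LLPO : branching bool LLPO.
Proof.
(* The single one of [X b k] sits at an odd index for [true], ruling out [const_seq 1], and at an
   even index for [false], ruling out [const_seq 0]. *)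
set (X := fun (b : bool) k i =>
  if i =? 2 * k + (if b then 1 else 0) then 1 else 0).
assert (D0 : dom LLPO (const_seq 0)).
{ exists (const_seq 0); split; [intros i j Hi; now elim Hi|].
  left; split; reflexivity. }
assert (Xu : forall b k i j, X b k i <> 0 -> X b k j <> 0 -> i = j).
{ intros b k i j; unfold X.
  destruct (Nat.eqb_spec i (2 * k + (if b then 1 else 0)));
    destruct (Nat.eqb_spec j (2 * k + (if b then 1 else 0))); lia. }
exists (const_seq 0), X; split; [exact D0|split].
- intros b; split; [exact D0|split].
  + intros k; exists (const_seq (if b then 0 else 1)); split; [apply Xu|].
    unfold X; destruct b; [left|right]; split; try reflexivity; intros i.
    * destruct (Nat.eqb_spec (2 * i) (2 * k + 1)); [lia|reflexivity].
    * destruct (Nat.eqb_spec (2 * i + 1) (2 * k + 0)); [lia|reflexivity].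
  + intros n; exists n; intros k Hk i Hi; unfold const_seq, X.
    destruct (Nat.eqb_spec i (2 * k + (if b then 1 else 0))); [lia|reflexivity].
- intros y [_ [[-> _]|[-> _]]]; [exists false|exists true]; exists 1;
    intros k _ z [_ [[-> Hz]|[-> Hz]]] A;
    try discriminate (A 0 ltac:(lia)); specialize (Hz k); unfold X in Hz.
  + rewrite Nat.add_0_r, Nat.eqb_refl in Hz; discriminate.
  + rewrite Nat.eqb_refl in Hz; discriminate.
Qed.

(** This is what two [bool] branchings generate under [par]: the [r] component selects the isolated
    row [a], the [q] component the isolated column [b]. *)
Definition grid (f : problem) : Prop :=
  exists x (X : bool -> bool -> nat -> baire),
    dom f x /\ (forall a b, approach f (X a b) x) /\
    forall y, f x y ->
      (exists a, forall b, isolated f (X a b) y) /\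
      (exists b, forall a, isolated f (X a b) y).

Lemma grid_wle f g : wle f g -> grid f -> grid g.
Proof.
intros W (x & X & Dx & HX & Hy).
destruct (wle_transport _ _ W) as (K & KD & Kapp & Kiso).
exists (K x), (fun a b k => K (X a b k)); split; [apply KD, Dx|split].
- intros a b; apply (Kapp _ _ (HX a b)).
- intros y Gy.
  destruct (Kiso x y Dx Gy) as (w & Fw & Hw).
  destruct (Hy w Fw) as [[a Ha] [b Hb]].
  split; [exists a|exists b]; auto.
Qed.

Lemma grid_par r q : branching bool r -> branching bool q -> grid (par r q).
Proof.
intros (x & X & Dx & HX & Hx) (v & V & Dv & HV & Hv).
exists (bpair x v), (fun a b k => bpair (X a k) (V b k)); split; [|split].
- apply par_dom; auto.
- intros a b; apply par_approach; auto.
- intros w (y & z & Qy & Rz & ->)%par_spec; auto.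
  destruct (Hx z Rz) as [a Ha], (Hv y Qy) as [b Hb].
  split; [exists a; intros b'|exists b; intros a'];
    apply par_isolated; auto; apply HX.
Qed.

(** The non-zero entry at [i] persists in [X k] and is then its only one, so every solution at [x]
    remains a solution at [X k]. *)
Lemma LLPO_not_isolated X x i y : x i <> 0 -> approach LLPO X x ->
  LLPO x y -> ~ isolated LLPO X y.
Proof.
intros Hi (_ & DX & HX) [_ Hy] [m Hm]; destruct (HX (S i)) as [K HK].
set (k := max m K).
assert (Hk : X k i <> 0)
  by (rewrite <- (HK k ltac:(lia) i ltac:(lia)); exact Hi).
destruct (DX k) as (z & Hu & _).
assert (H0 : forall j, j <> i -> X k j = 0).
{ intros j Hj; apply NNPP; intros Hk'; exact (Hj (Hu _ _ Hk' Hk)). }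
apply (Hm k ltac:(lia) y); [|intros j _; reflexivity].
split; [exact Hu|].
destruct Hy as [[-> H]|[-> H]]; [left|right]; split; try reflexivity;
  intros j; apply H0; intros <-; apply Hi, H.
Qed.

(** When the input is zero both solutions are allowed; the cell isolating
    [const_seq 0] by its row and [const_seq 1] by its column has none left. *)
Lemma not_grid_LLPO : ~ grid LLPO.
Proof.
intros (x & X & [y Ly] & HX & Hx).
destruct (classic (exists i, x i <> 0)) as [[i Hi]|Hz].
- destruct (Hx y Ly) as [[a Ha] _].
  (* Row [a] isolates in both columns; [true] is an arbitrary choice. *)
  exact (LLPO_not_isolated _ _ _ _ Hi (HX a true) Ly (Ha true)).
- assert (H0 : forall i, x i = 0)
    by (intros i; apply NNPP; intros H; apply Hz; eauto).
  destruct (Hx (const_seq 0)) as [[a Ha] _].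
  { split; [apply Ly|left; split; auto]. }
  destruct (Hx (const_seq 1)) as [_ [b Hb]].
  { split; [apply Ly|right; split; auto]. }
  destruct (Ha b) as [m Hm], (Hb a) as [l Hl].
  destruct (HX a b) as (_ & DX & _).
  destruct (DX (max m l)) as [z Lz].
  destruct Lz as [Hu [[-> Hz']|[-> Hz']]].
  + apply (Hm (max m l) ltac:(lia) (const_seq 0)); [|intros i _; reflexivity].
    split; auto.
  + apply (Hl (max m l) ltac:(lia) (const_seq 1)); [|intros i _; reflexivity].
    split; auto.
Qed.

Theorem theorem1p7 :
  forall n : nat, 2 <= n ->
    (~ exists r : problem, is_root n r LPO) /\
    (~ exists r : problem, is_root n r LLPO).
Proof.
intros n Hn; split; intros [r Hr].
- destruct (branching_root _ _ _ _ Hn Hr branching_LPO)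
    as (q & p & Br & Bq & Wp & Wf).
  apply not_nested_LPO, (nested_wle _ _ Wf), (nested_wle _ _ Wp).
  exact (nested_par _ _ Br Bq).
- destruct (branching_root _ _ _ _ Hn Hr branching_LLPO)
    as (q & p & Br & Bq & Wp & Wf).
  apply not_grid_LLPO, (grid_wle _ _ Wf), (grid_wle _ _ Wp).
  exact (grid_par _ _ Br Bq).
Qed.
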